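(* Let $\varepsilon\in\{1,-1\}$ and equip $M=\mathbb{R}^3$ (coordinates $(X_1,X_2,X_3)$, $\partial_i=\partial/\partial X_i$) with the metric $g=e^{2X_3}dX_1^2+e^{-2X_3}dX_2^2+\varepsilon\, dX_3^2$. Let $a=a(X_3)$ be a continuous function of $X_3$, let $\widehat P=a(X_3)\partial_3$, and let $\widehat\nabla_XY=\nabla_XY+g(\widehat P,Y)X$, where $\nabla$ is the Levi-Civita connection of $g$. Let $R,C,K,W,P$ be the $(0,4)$ Riemann, Weyl conformal, conharmonic, concircular and projective curvature tensors, and $Ric$ the Ricci tensor, of $\widehat\nabla$ (as defined in the context). Then: (I) The following identities hold (so that the corresponding semisymmetric type, pseudosymmetric type, or Ricci generalized pseudosymmetric type conditions hold): (1) $C\cdot R=0$; (2) $K\cdot R=-Q(Ric,R)$; (3) $W\cdot R=\frac23 Q(Ric,R)$; (4) $P\cdot R=\frac12 Q(Ric,R)$; (5) $K\cdot R=-\varepsilon Q(g,R)$; (6) $W\cdot R=\frac23\varepsilon Q(g,R)$; (7) $P\cdot R=\frac12\varepsilon Q(g,R)$; (8) $R\cdot C=0$; (9) $C\cdot C=0$; (10) $K\cdot C=0$; (11) $W\cdot C=0$; (12) $P\cdot C=0$; (13) $R\cdot K=0$; (14) $C\cdot K=0$; (15) $K\cdot K=0$; (16) $W\cdot K=0$; (17) $P\cdot K=-\frac12 Q(Ric,K)$; (18) $R\cdot W=\frac34 Q(Ric,W)$; (19) $K\cdot W=-\frac34 Q(Ric,W)$; (20) $W\cdot W=\frac12 Q(Ric,W)$;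 (21) $P\cdot W=\frac14 Q(Ric,W)$; (22) $R\cdot W=\varepsilon Q(g,W)$; (23) $K\cdot W=-\varepsilon Q(g,W)$; (24) $W\cdot W=\frac23\varepsilon Q(g,W)$; (25) $P\cdot W=\frac13\varepsilon Q(g,W)$; (26) $R\cdot P=\varepsilon Q(g,P)$; (27) $K\cdot P=-\varepsilon Q(g,P)$; (28) $W\cdot P=\frac23\varepsilon Q(g,P)$. (II) $Ric=\alpha\,(\eta\otimes\eta)$ with $\alpha=2$ and $\eta=dX_3$ (components $\{0,0,1\}$). Thus $M$ is a Ricci simple manifold, and it is a $2$-quasi-Einstein manifold with $\operatorname{rank}(Ric-\alpha g)=2$ when $\varepsilon=1$, and a $3$-quasi-Einstein manifold with $\operatorname{rank}(Ric-\alpha g)=3$ when $\varepsilon=-1$. (III) $R=g\wedge Ric-\frac{\varepsilon}{2}\,g\wedge g$; hence $M$ is a generalized Roter type manifold. (IV) $Ric^2-2\varepsilon\, Ric=0$; hence $M$ is an Einstein manifold of level $2$. (V) $Ric$ is neither of Codazzi type nor cyclic parallel (with respect to $\widehat\nabla$). (VI) $Ric$ is $R$-compatible, $C$-compatible, $K$-compatible and $W$-compatible. (VII) The curvature $2$-forms of (1) the Riemann curvature $R$, (2) the conharmonic curvature $K$, (3) the concircular curvature $W$ are recurrent (with respect to $\widehat\nabla$), in each case with the $1$-form $\sigma=2\varepsilon a(X_3)\,dX_3$.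
   Context: Here $n=3$; repeated indices are summed over $1,2,3$. Christoffel coefficients: $\widehat\nabla_{\partial_k}\partial_j=\widehat\Gamma^\alpha_{kj}\partial_\alpha$. The non-zero ones are $\widehat\Gamma^1_{13}=1+\varepsilon a$, $\widehat\Gamma^1_{31}=1$, $\widehat\Gamma^2_{23}=-1+\varepsilon a$, $\widehat\Gamma^2_{32}=-1$, $\widehat\Gamma^3_{11}=-\varepsilon e^{2X_3}$, $\widehat\Gamma^3_{22}=\varepsilon e^{-2X_3}$, $\widehat\Gamma^3_{33}=\varepsilon a$. Curvature. The $(0,4)$ Riemann curvature has components $$R_{hkij}=g_{h\alpha}\left(\partial_i\widehat\Gamma^\alpha_{kj}-\partial_j\widehat\Gamma^\alpha_{ki}+\widehat\Gamma^\beta_{kj}\widehat\Gamma^\alpha_{\beta i}-\widehat\Gamma^\beta_{ki}\widehat\Gamma^\alpha_{\beta j}\right),$$ where the coefficients $\widehat\Gamma^\alpha_{kj}$ are inserted with lower indices in exactly the printed order. To a $(0,4)$ tensor $E$ is associated the endomorphism-valued $\mathcal E$ by $g(\mathcal E(U_1,U_2)U_3,U_4)=E(U_1,U_2,U_3,U_4)$; $E_{hkij}=E(\partial_h,\partial_k,\partial_i,\partial_j)$. With $\mathcal E_R$ associated to $R$, $Ric(Y_1,Y_2)=\operatorname{tr}\{X\mapsto\mathcal E_R(X,Y_1)Y_2\}$, i.e. $Ric_{ij}=g^{hl}R_{hijl}$; $\kappa=g^{ij}Ric_{ij}$; the Ricci operator $\mathcal J$ is given by $Ric(Y_1,Y_2)=g(Y_1,\mathcal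 JY_2)$, and $Ric^k(Y_1,Y_2)=g(Y_1,\mathcal J^{k}Y_2)$ (so $Ric^1=Ric$). Kulkarni-Nomizu product of $(0,2)$-tensors $A,E$: $(A\wedge E)(Y_1,Y_2,U_1,U_2)=A(Y_1,U_2)E(Y_2,U_1)-A(Y_1,U_1)E(Y_2,U_2)+A(Y_2,U_1)E(Y_1,U_2)-A(Y_2,U_2)E(Y_1,U_1)$. Derived tensors: $C=R-\frac1{n-2}\,g\wedge Ric+\frac{\kappa}{2(n-1)(n-2)}\,g\wedge g$; $K=R-\frac1{n-2}\,g\wedge Ric$; $W=R-\frac{\kappa}{2n(n-1)}\,g\wedge g$; $P_{hkij}=R_{hkij}-\frac1{n-1}(g_{hj}Ric_{ki}-g_{kj}Ric_{hi})$. For a $(0,4)$ tensor $E$ with associated $\mathcal E$ and a $(0,k)$ tensor $F$: $(E\cdot F)(Y_1,\dots,Y_k,U_1,U_2)=-F(\mathcal E(U_1,U_2)Y_1,Y_2,\dots,Y_k)-\cdots-F(Y_1,\dots,\mathcal E(U_1,U_2)Y_k)$. For a $(0,2)$ tensor $Z$: $Q(Z,F)(Y_1,\dots,Y_k,U_1,U_2)=Z(U_1,Y_1)F(U_2,Y_2,\dots,Y_k)+\cdots+Z(U_1,Y_k)F(Y_1,\dots,Y_{k-1},U_2)-Z(U_2,Y_1)F(U_1,Y_2,\dots,Y_k)-\cdots-Z(U_2,Y_k)F(Y_1,\dots,Y_{k-1},U_1)$. Terminology. $M$ is $F$-semisymmetric type due to $E$ if $E\cdot F=0$; $F$-pseudosymmetric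 type due to $E$ if $E\cdot F$ is linearly dependent with $Q(Z,F)$; Ricci generalized $F$-pseudosymmetric type due to $E$ if $E\cdot F=f\,Q(Ric,F)$ for a scalar function $f$. $M$ is $k$-quasi-Einstein if $\operatorname{rank}(Ric-\alpha g)=k$ for a scalar $\alpha$; quasi-Einstein means $k=1$; Ricci simple means quasi-Einstein with $\alpha=0$. $M$ is generalized Roter type if $R=(\mu_{11}Ric^2+\mu_{12}Ric+\mu_{13}g)\wedge Ric^2+(\mu_{22}Ric+\mu_{23}g)\wedge Ric+\mu_{33}(g\wedge g)$ for some scalars $\mu_{ij}$. $M$ is Einstein of level $2$ if $Ric^2+\lambda_1Ric+\lambda_2g=0$ for some scalars $\lambda_1,\lambda_2$. Covariant derivative of a $(0,k)$ tensor: $(\widehat\nabla_XT)(Y_1,\dots,Y_k)=X(T(Y_1,\dots,Y_k))-\sum_iT(Y_1,\dots,\widehat\nabla_XY_i,\dots,Y_k)$. $\mathcal S_{Y_1,Y_2,Y_3}$ denotes the cyclic sum. $Ric$ is cyclic parallel if $\mathcal S_{Y_1,Y_2,Y_3}(\widehat\nabla_{Y_1}Ric)(Y_2,Y_3)=0$, and Codazzi if $(\widehat\nabla_{Y_1}Ric)(Y_2,Y_3)=(\widehat\nabla_{Y_2}Ric)(Y_1,Y_3)$, for all vector fields. A symmetric $(0,2)$-tensor $Z$, with $g(\mathcal ZY_1,Y_2)=Z(Y_1,Y_2)$, is $T$-compatible if $\mathcal S_{Y_1,Y_2,Y_3}T(\mathcal ZY_1,U,Y_2,Y_3)=0$ for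 all vector fields. The curvature $2$-forms of a $(0,4)$ tensor $E$ are recurrent with $1$-form $\sigma$ if $\mathcal S_{Y_1,Y_2,Y_3}(\widehat\nabla_{Y_1}E)(Y_2,Y_3,U,Y)=\mathcal S_{Y_1,Y_2,Y_3}\sigma(Y_1)E(Y_2,Y_3,U,Y)$ for all vector fields. *)

(* Defs.v *)
From mathcomp Require Import all_boot all_order all_algebra.
From mathcomp Require Import all_classical all_reals all_analysis.

Set Implicit Arguments.
Unset Strict Implicit.
Unset Printing Implicit Defensive.

Import Order.TTheory GRing.Theory Num.Theory.
Import numFieldNormedType.Exports.
Local Open Scope ring_scope.

(* The manifold is R^n in its global chart, with points 'rV[R]_n; a tangent
   vector at a point is again an element of 'rV[R]_n, and the coordinate field
   d/dX_(i+1) is the constant field delta_mx 0 i (indices start at 0 here).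
   The first argument of a (0,k) tensor field is the base point.  These are
   plain function types, so that +, - and *: on tensor fields are the
   pointwise operations. *)
Notation vfield R n := ('rV[R]_n -> 'rV[R]_n).
Notation form1 R n := ('rV[R]_n -> 'rV[R]_n -> R).
Notation form2 R n := ('rV[R]_n -> form1 R n).
Notation form4 R n := ('rV[R]_n -> 'rV[R]_n -> form2 R n).
Notation form6 R n := ('rV[R]_n -> 'rV[R]_n -> form4 R n).

Definition coordv (R : realType) (n : nat) (i : 'I_n) : 'rV[R]_n :=
  delta_mx 0 i.

Definition partial (R : realType) (n : nat) (V : normedModType R) (i : 'I_n)
    (f : 'rV[R]_n -> V) : 'rV[R]_n -> V :=
  fun x => 'D_(coordv R i) f x.

Definition smooth (R : realType) (n : nat) (V : normedModType R)
    (f : 'rV[R]_n -> V) : Prop :=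
  forall (s : seq 'I_n) (x : 'rV[R]_n),
    differentiable (foldr (fun i h => partial i h) f s) x.

Section Geometry.
Context {R : realType} {n : nat}.
Implicit Types (g : 'rV[R]_n -> 'M[R]_n) (x u v w : 'rV[R]_n).
Implicit Types (X Y : vfield R n) (S Z : form2 R n) (E F T : form4 R n).
Implicit Types (nab : vfield R n -> vfield R n -> vfield R n).

Definition metric_form g : form2 R n :=
  fun x u v => (u *m g x *m v^T) 0 0.

(* The vector w such that g(w, v) = phi v for every v, for phi linear. *)
Definition sharp g x (phi : 'rV[R]_n -> R) : 'rV[R]_n :=
  \row_al \sum_l invmx (g x) al l * phi (coordv R l).

(* Gamma^al_{kj} of the Levi-Civita connection. *)
Definition christoffel g (al k j : 'I_n) x : R :=
  2^-1 * \sum_l invmx (g x) al l *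
    (partial k (fun y => g y l j) x + partial j (fun y => g y k l) x
     - partial l (fun y => g y k j) x).

Definition levi_civita g X Y : vfield R n :=
  fun x => 'D_(X x) Y x +
    \row_al \sum_k \sum_j christoffel g al k j x * X x 0 k * Y x 0 j.

Definition semisym_conn g (Phat : vfield R n) X Y : vfield R n :=
  fun x => levi_civita g X Y x + metric_form g x (Phat x) (Y x) *: X x.

(* The coefficient of index al of nab_(d_k) d_j; the order of k and j matters
   as nab need not be torsion-free. *)
Definition conn_coef nab (al k j : 'I_n) x : R :=
  nab (fun _ => coordv R k) (fun _ => coordv R j) x 0 al.

Definition riemann_coef g nab (h k i j : 'I_n) x : R :=
  \sum_al g x h al *
    (partial i (conn_coef nab al k j) x - partial j (conn_coef nab al k i) x
     + \sum_be (conn_coef nab be k j x * conn_coef nab al be i x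
                - conn_coef nab be k i x * conn_coef nab al be j x)).

Definition riemann g nab : form4 R n := fun x u1 u2 u3 u4 =>
  \sum_h \sum_k \sum_i \sum_j
    riemann_coef g nab h k i j x * u1 0 h * u2 0 k * u3 0 i * u4 0 j.

(* g(endo E u1 u2 u3, u4) = E(u1, u2, u3, u4). *)
Definition endo g E x u1 u2 u3 : 'rV[R]_n := sharp g x (E x u1 u2 u3).

(* Trace of u |-> endo E u y1 y2. *)
Definition ricci_of g E : form2 R n := fun x y1 y2 =>
  \sum_h endo g E x (coordv R h) y1 y2 0 h.

Definition scalar_of g S x : R :=
  \sum_i \sum_j invmx (g x) i j * S x (coordv R i) (coordv R j).

(* S(u, v) = g(u, oper_r S v). *)
Definition oper_r g S x v : 'rV[R]_n := sharp g x (fun u => S x u v).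

(* g(oper_l Z u, v) = Z(u, v). *)
Definition oper_l g Z x u : 'rV[R]_n := sharp g x (Z x u).

Definition form2_pow g S (k : nat) : form2 R n := fun x u v =>
  metric_form g x u (iter k (oper_r g S x) v).

Definition kulkarni_nomizu (A B : form2 R n) : form4 R n :=
  fun x y1 y2 u1 u2 =>
    A x y1 u2 * B x y2 u1 - A x y1 u1 * B x y2 u2
    + A x y2 u1 * B x y1 u2 - A x y2 u2 * B x y1 u1.

Definition scale_fun (f : 'rV[R]_n -> R) E : form4 R n :=
  fun x => f x *: E x.

Definition scale_fun2 (f : 'rV[R]_n -> R) S : form2 R n :=
  fun x => f x *: S x.

Definition conharmonic g (Rm : form4 R n) : form4 R n :=
  Rm - (n%:R - 2)^-1 *: kulkarni_nomizu (metric_form g) (ricci_of g Rm).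

Definition conformal g (Rm : form4 R n) : form4 R n :=
  Rm - (n%:R - 2)^-1 *: kulkarni_nomizu (metric_form g) (ricci_of g Rm)
  + scale_fun
      (fun x => scalar_of g (ricci_of g Rm) x / (2 * (n%:R - 1) * (n%:R - 2)))
      (kulkarni_nomizu (metric_form g) (metric_form g)).

Definition concircular g (Rm : form4 R n) : form4 R n :=
  Rm - scale_fun
         (fun x => scalar_of g (ricci_of g Rm) x / (2 * n%:R * (n%:R - 1)))
         (kulkarni_nomizu (metric_form g) (metric_form g)).

Definition projective g (Rm : form4 R n) : form4 R n :=
  fun x h k i j => Rm x h k i j - (n%:R - 1)^-1 *
    (metric_form g x h j * ricci_of g Rm x k i
     - metric_form g x k j * ricci_of g Rm x h i).

(* The tensor E . F; in this definition and the next, F has order 4. *)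
Definition curv_dot g E F : form6 R n := fun x y1 y2 y3 y4 u1 u2 =>
  let A := endo g E x u1 u2 in
  - F x (A y1) y2 y3 y4 - F x y1 (A y2) y3 y4
  - F x y1 y2 (A y3) y4 - F x y1 y2 y3 (A y4).

(* The tensor Q(Z, F). *)
Definition tachibana Z F : form6 R n := fun x y1 y2 y3 y4 u1 u2 =>
  Z x u1 y1 * F x u2 y2 y3 y4 + Z x u1 y2 * F x y1 u2 y3 y4
  + Z x u1 y3 * F x y1 y2 u2 y4 + Z x u1 y4 * F x y1 y2 y3 u2
  - Z x u2 y1 * F x u1 y2 y3 y4 - Z x u2 y2 * F x y1 u1 y3 y4
  - Z x u2 y3 * F x y1 y2 u1 y4 - Z x u2 y4 * F x y1 y2 y3 u1.

(* In the next definitions, F is of the given type due to E. *)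
Definition semisymmetric_type g F E : Prop := curv_dot g E F = 0.

(* Linear dependence of tensor fields is understood at every point. *)
Definition pseudosymmetric_type g Z F E : Prop :=
  forall x, exists s t : R, (s, t) != (0, 0) /\
    s *: curv_dot g E F x + t *: tachibana Z F x = 0.

Definition ricci_gen_pseudosymmetric_type g (Ric : form2 R n) F E : Prop :=
  exists2 f : 'rV[R]_n -> R, smooth f &
    forall x, curv_dot g E F x = f x *: tachibana Ric F x.

Definition form2_mx S x : 'M[R]_n :=
  \matrix_(i, j) S x (coordv R i) (coordv R j).

Definition quasi_einstein_with g (Ric : form2 R n) (alpha : 'rV[R]_n -> R)
    (k : nat) : Prop :=
  forall x, \rank (form2_mx Ric x - alpha x *: g x) = k.

Definition quasi_einstein g (Ric : form2 R n) (k : nat) : Prop :=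
  exists2 alpha : 'rV[R]_n -> R, smooth alpha &
    quasi_einstein_with g Ric alpha k.

Definition ricci_simple g (Ric : form2 R n) : Prop :=
  quasi_einstein_with g Ric (fun _ => 0) 1.

Definition generalized_roter g (Rm : form4 R n) : Prop :=
  let G := metric_form g in
  let Ric := ricci_of g Rm in
  let Ric2 := form2_pow g Ric 2 in
  exists m11 m12 m13 m22 m23 m33 : 'rV[R]_n -> R,
    (smooth m11 /\ smooth m12 /\ smooth m13 /\
     smooth m22 /\ smooth m23 /\ smooth m33) /\
    Rm = kulkarni_nomizu
           (scale_fun2 m11 Ric2 + scale_fun2 m12 Ric + scale_fun2 m13 G) Ric2
         + kulkarni_nomizu (scale_fun2 m22 Ric + scale_fun2 m23 G) Ric
         + scale_fun m33 (kulkarni_nomizu G G).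

Definition einstein_level2 g (Ric : form2 R n) : Prop :=
  exists l1 l2 : 'rV[R]_n -> R, smooth l1 /\ smooth l2 /\
    form2_pow g Ric 2 + scale_fun2 l1 Ric + scale_fun2 l2 (metric_form g) = 0.

Definition cov_deriv2 nab S X Y1 Y2 x : R :=
  'D_(X x) (fun y => S y (Y1 y) (Y2 y)) x
  - S x (nab X Y1 x) (Y2 x) - S x (Y1 x) (nab X Y2 x).

Definition cov_deriv4 nab T X Y1 Y2 Y3 Y4 x : R :=
  'D_(X x) (fun y => T y (Y1 y) (Y2 y) (Y3 y) (Y4 y)) x
  - T x (nab X Y1 x) (Y2 x) (Y3 x) (Y4 x)
  - T x (Y1 x) (nab X Y2 x) (Y3 x) (Y4 x)
  - T x (Y1 x) (Y2 x) (nab X Y3 x) (Y4 x)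
  - T x (Y1 x) (Y2 x) (Y3 x) (nab X Y4 x).

Definition cyclic_parallel nab S : Prop :=
  forall Y1 Y2 Y3 : vfield R n, smooth Y1 -> smooth Y2 -> smooth Y3 ->
  forall x, cov_deriv2 nab S Y1 Y2 Y3 x + cov_deriv2 nab S Y2 Y3 Y1 x
            + cov_deriv2 nab S Y3 Y1 Y2 x = 0.

Definition codazzi nab S : Prop :=
  forall Y1 Y2 Y3 : vfield R n, smooth Y1 -> smooth Y2 -> smooth Y3 ->
  forall x, cov_deriv2 nab S Y1 Y2 Y3 x = cov_deriv2 nab S Y2 Y1 Y3 x.

Definition compatible g Z T : Prop :=
  forall x u y1 y2 y3 : 'rV[R]_n,
    T x (oper_l g Z x y1) u y2 y3 + T x (oper_l g Z x y2) u y3 y1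
    + T x (oper_l g Z x y3) u y1 y2 = 0.

Definition recurrent_2forms nab E (sigma : form1 R n) : Prop :=
  forall Y1 Y2 Y3 U Y : vfield R n,
    smooth Y1 -> smooth Y2 -> smooth Y3 -> smooth U -> smooth Y ->
  forall x,
    cov_deriv4 nab E Y1 Y2 Y3 U Y x + cov_deriv4 nab E Y2 Y3 Y1 U Y x
    + cov_deriv4 nab E Y3 Y1 Y2 U Y x
    = sigma x (Y1 x) * E x (Y2 x) (Y3 x) (U x) (Y x)
      + sigma x (Y2 x) * E x (Y3 x) (Y1 x) (U x) (Y x)
      + sigma x (Y3 x) * E x (Y1 x) (Y2 x) (U x) (Y x).

End Geometry.

Definition i3 : 'I_3 := ord_max.

Definition sol_metric (R : realType) (eps : R) (x : 'rV[R]_3) : 'M[R]_3 :=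
  diag_mx (\row_(i < 3)
    [:: expR (2 * x 0 i3); expR (- (2 * x 0 i3)); eps]`_i).

(* When a is merely continuous, the coefficients of semisym_conn with this field
   may fail to be differentiable along X_3.  This is harmless in riemann_coef:
   a enters only the coefficients with j = 3, so that its derivative along X_3
   occurs only for i = j, where the two derivative terms are identical and
   cancel. *)
Definition sol_Phat (R : realType) (a : R -> R) : vfield R 3 :=
  fun x => a (x 0 i3) *: coordv R i3.

(* Main.v *)
Require Import Defs.
From mathcomp Require Import all_boot all_order all_algebra.
From mathcomp Require Import all_classical all_reals all_analysis.
From mathcomp Require Import ring lra.
Import Order.TTheory GRing.Theory Num.Theory.
Import numFieldNormedType.Exports.
Local Open Scope ring_scope.

(** Everything follows from the form of the curvature.  Split the metric as
[g = h + eps * eta (x) eta], where [eta = dX_3] and [h] is the metric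
[e^(2 X_3) dX_1^2 + e^(-2 X_3) dX_2^2] of the leaves [X_3 = const].  The
metric is diagonal and depends on [X_3] only, so the connection coefficients
are short.

The function [a] is invisible to the curvature.  With [phi = eps a dX_3] the
connection has coefficients [L^al_(kj) + phi_j delta^al_k], [L] being those of
the Levi-Civita connection.  Inserted in the formula for [R], the quadratic part
acquires the terms [phi_i L^al_(kj) + phi_j L^al_(ki) + phi_i phi_j delta^al_k],
symmetric in [i] and [j], and the linear part acquires [d phi = 0]; the latter
holds without differentiating [a], since the only derivative involved would be
that of [phi_3] along [X_3], which is subtracted from itself.  One finds
([riemannE]) [R = h ^ (eta (x) eta) - (eps / 2) h ^ h], with [^] the
Kulkarni-Nomizu product.

Hence [R] lies in the plane of tensors
[T(p, q) = p h ^ (eta (x) eta) + q h ^ h], the curvature-like tensors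
invariant under the rotations of the leaves ([hcurv]).  Its Ricci tensor is
[2 eta (x) eta] and its scalar curvature [2 eps], and since
[g ^ g = T(2 eps, 1)], also [K = T(-1, -eps/2)], [W = T(2/3, -2 eps/3)] and
[C = T(0, 0) = 0].  The algebraic conditions on [Ric], the decomposition of [R]
and the compatibility relations can be read off from this.

For the products [E . F], write
[T(p, q) = (p eps / 2) g ^ g + (q - p eps / 2) h ^ h].  The derivation attached
to [(1/2) g ^ g] sends every tensor [F] to [Q(g, F)], while the one attached to
[h ^ h] is an infinitesimal rotation of the leaves, which kills every tensor
built from [h] and [eta].  So [T(p, q) . F = p eps Q(g, F)] when [F] is any of
the curvature tensors ([curv_dot_pairing]).  The tensor [P] is [R] plus a
correction whose derivation is [- Q(eta (x) eta, F)]
([curv_dot_projective_pairing]).  Finally [Q(g, T)] and [Q(eta (x) eta, T)] are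
explicit multiples of the single tensor [Q(eta (x) eta, h ^ h)], by polarisation
of [Q(Z, Z ^ Z) = 0].  Thus the identities with [F] different from [P] become
equalities between scalars, and those with [F = P] are instances of
[curv_dot_pairing].

The differential statements need the covariant derivatives of [h] and [eta],
which involve, besides [a], the form
[b = e^(2 X_3) dX_1^2 - e^(-2 X_3) dX_2^2].  In the cyclic sum for the curvature
2-forms the terms in [b] disappear because [b] is trace-free with respect to
[h] on two-dimensional leaves, and what is left is [2 eps a eta] times the
curvature ([recurrent_hcurv]).  The component
[(nabla_1 Ric)(d_1, d_3) = 2 eps e^(2 X_3)] refutes both the Codazzi equation
and cyclic parallelism. *)

(** * Three-element index sets *)

Definition i1 : 'I_3 := ord0.
Definition i2 : 'I_3 := lift ord0 ord0.

Lemma lift2_i3 : lift ord0 (lift ord0 ord0) = i3 :> 'I_3.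
Proof. exact: val_inj. Qed.

Lemma sum3E (V : nmodType) (F : 'I_3 -> V) :
  \sum_(i < 3) F i = F i1 + F i2 + F i3.
Proof. by rewrite !big_ord_recl big_ord0 addr0 lift2_i3 addrA. Qed.

Lemma ord3_ind (P : 'I_3 -> Prop) : P i1 -> P i2 -> P i3 -> forall i, P i.
Proof.
by move=> P1 P2 P3 [[|[|[|//]]] hi]; [move: P1|move: P2|move: P3];
   congr P; apply: val_inj.
Qed.

Lemma ord3_eqE : ((i1 == i2) = false) * ((i1 == i3) = false) *
  ((i2 == i1) = false) * ((i2 == i3) = false) * ((i3 == i1) = false) *
  ((i3 == i2) = false).
Proof. by []. Qed.

(** * Derivatives on coordinate space *)

Section Calculus.
Context {R : realType} {n : nat}.

(** The chain rule through a coordinate: the metric coefficients and [a] are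
    functions of [X_3] alone. *)
Lemma is_derive_coord (x v : 'rV[R]_n) (i : 'I_n) (phi : R -> R) (d : R) :
  is_derive (x 0 i) 1 phi d ->
  is_derive x v (fun y : 'rV[R]_n => phi (y 0 i)) (v 0 i * d).
Proof.
move=> dphi.
have cphi : differentiable phi (x 0 i) by apply/derivable1_diffP; case: dphi.
have cc := @differentiable_coord R 1 n x 0 i.
have c := differentiable_comp cc cphi.
split; first exact: diff_derivable.
rewrite deriveE // diff_comp //=.
have -> : 'd (fun y : 'rV[R]_n => y 0 i) x v = v 0 i.
  rewrite -deriveE //.
  have := @derive_mx R 'rV[R]_n 1 n id x v (@derivable_id _ _ _ _).
  by rewrite derive_id => /matrixP/(_ 0 i); rewrite mxE => <-.
rewrite (_ : 'd phi _ _ = 'd phi (x 0 i) (v 0 i *: 1)); last first.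
  by rewrite -[v 0 i *: 1]/(v 0 i * 1) mulr1.
by rewrite linearZ -deriveE // derive_val.
Qed.

Lemma is_derive_entry (Y : 'rV[R]_n -> 'rV[R]_n) (x v : 'rV[R]_n) (i : 'I_n) :
  differentiable Y x ->
  is_derive x v (fun y => Y y 0 i : R) (('D_v Y x) 0 i).
Proof.
move=> dY; split.
  apply: diff_derivable.
  exact: (differentiable_comp dY (differentiable_coord _ _ _)).
by rewrite derive_mx ?mxE //; exact: diff_derivable.
Qed.

Lemma partial_const (V : normedModType R) (i : 'I_n) (c : V) :
  partial i (fun _ : 'rV[R]_n => c) = fun _ => 0.
Proof. by apply/funext => x; exact: derive_cst. Qed.

Lemma smooth_const (V : normedModType R) (c : V) :
  smooth (fun _ : 'rV[R]_n => c).
Proof.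
move=> s x.
have [d ->] : exists d, foldr (fun i h => partial i h) (fun _ : 'rV[R]_n => c) s
    = fun _ => d.
  elim: s => [|i s [d IH]] /=; first by exists c.
  by exists 0; rewrite IH partial_const.
exact: differentiable_cst.
Qed.

(** No regularity of [phi] is assumed: the increments vanish identically. This
    matters because [a] is only continuous. *)
Lemma partial_other (V : normedModType R) (i j : 'I_n) (phi : R -> V) x :
  i != j -> partial i (fun y : 'rV[R]_n => phi (y 0 j)) x = 0.
Proof.
move=> ij; rewrite /partial /derive.
rewrite (_ : (fun h : R => _) = fun=> 0); first exact: lim_cst.
apply/funext => h /=; rewrite !mxE eqxx eq_sym (negbTE ij) /=.
by rewrite mulr0 add0r subrr scaler0.
Qed.
End Calculus.

(** * Tensor fields as functions *)

Section Types.
Context {R : realType}.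
Implicit Types (g : 'rV[R]_3 -> 'M[R]_3).

Lemma scale6E (c : R) (A : form6 R 3) x y1 y2 y3 y4 u1 u2 :
  (c *: A) x y1 y2 y3 y4 u1 u2 = c * A x y1 y2 y3 y4 u1 u2.
Proof. by []. Qed.

Lemma sub6E (A B : form6 R 3) x y1 y2 y3 y4 u1 u2 :
  (A - B) x y1 y2 y3 y4 u1 u2 = A x y1 y2 y3 y4 u1 u2 - B x y1 y2 y3 y4 u1 u2.
Proof. by []. Qed.

Lemma opp6E (A : form6 R 3) x y1 y2 y3 y4 u1 u2 :
  (- A) x y1 y2 y3 y4 u1 u2 = - A x y1 y2 y3 y4 u1 u2.
Proof. by []. Qed.

Lemma zero6E x y1 y2 y3 y4 u1 u2 : (0 : form6 R 3) x y1 y2 y3 y4 u1 u2 = 0.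
Proof. by []. Qed.

Lemma form6P (A B : form6 R 3) :
  (forall x y1 y2 y3 y4 u1 u2, A x y1 y2 y3 y4 u1 u2 = B x y1 y2 y3 y4 u1 u2) ->
  A = B.
Proof. by move=> AB; do 7!(apply/funext => ?); exact: AB. Qed.

Lemma form4P (A B : form4 R 3) :
  (forall x y1 y2 y3 y4, A x y1 y2 y3 y4 = B x y1 y2 y3 y4) -> A = B.
Proof. by move=> AB; do 5!(apply/funext => ?); exact: AB. Qed.

(** The pair of coefficients is [(1, - c)], which is nonzero whatever [c]. *)
Lemma pseudosymmetric_type_of g Z (F E : form4 R 3) (c : R) :
  (forall x y1 y2 y3 y4 u1 u2, curv_dot g E F x y1 y2 y3 y4 u1 u2
     = c * tachibana Z F x y1 y2 y3 y4 u1 u2) ->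
  pseudosymmetric_type g Z F E.
Proof.
move=> EF x; exists 1, (- c); split; first by rewrite xpair_eqE oner_eq0.
do 6!(apply/funext => ?).
by rewrite -[LHS]/(1 * curv_dot _ _ _ _ _ _ _ _ _ _ + (- c) * _) EF;
   rewrite mul1r mulNr subrr.
Qed.

Lemma ricci_gen_pseudosymmetric_type_of g Z (F E : form4 R 3) (c : R) :
  (forall x y1 y2 y3 y4 u1 u2, curv_dot g E F x y1 y2 y3 y4 u1 u2
     = c * tachibana Z F x y1 y2 y3 y4 u1 u2) ->
  ricci_gen_pseudosymmetric_type g Z F E.
Proof.
move=> EF; exists (fun _ => c) => [|x]; first exact: smooth_const.
by do 6!(apply/funext => ?); rewrite EF.
Qed.
End Types.

(** * The metric *)

Section Sol.
Context {R : realType} (eps : R) (eps2 : eps * eps = 1) (a : R -> R).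

(** The diagonal entries of the metric, as functions of [t = X_3]. *)
Definition gcoef (t : R) (i : 'I_3) : R :=
  [:: expR (2 * t); expR (- (2 * t)); eps]`_i.

(** Half the logarithmic derivatives of the metric coefficients. *)
Definition grate (i : 'I_3) : R := [:: 1; -1; 0]`_i.

Lemma gcoefE t : (gcoef t i1 = expR (2 * t)) * (gcoef t i2 = expR (- (2 * t))) *
  (gcoef t i3 = eps).
Proof. by []. Qed.

Lemma grateE : (grate i1 = 1) * (grate i2 = -1) * (grate i3 = 0).
Proof. by []. Qed.

Lemma gcoef_neq0 t i : gcoef t i != 0.
Proof.
elim/ord3_ind: i; rewrite gcoefE; try by rewrite gt_eqF ?expR_gt0.
by apply/eqP => e0; move: eps2; rewrite e0 mul0r => /esym/eqP; rewrite oner_eq0.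
Qed.

Lemma is_derive_expRM (c t : R) :
  is_derive t (1 : R) (fun u => expR (c * u)) (c * expR (c * t)).
Proof.
have dc : is_derive t (1 : R) ( *%R c) c.
  have -> : *%R c = c \*: (@id R) by [].
  by apply: is_derive_eq; rewrite -[c *: 1]/(c * 1) mulr1.
have := is_derive1_comp (f := expR) (g := *%R c) (is_derive_expR (c * t)) dc.
by move=> d; apply: is_derive_eq d _; rewrite mulrC.
Qed.

Lemma is_derive_gcoef (t : R) (i : 'I_3) :
  is_derive t (1 : R) (gcoef^~ i) (2 * grate i * gcoef t i).
Proof.
elim/ord3_ind: i; rewrite !gcoefE !grateE ?mulr1 ?mulrN1 ?mulr0 ?mul0r.
- exact: is_derive_expRM.
- rewrite -mulNr [gcoef^~ i2](_ : _ = fun u => expR (- 2 * u)).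
    exact: is_derive_expRM.
  by apply/funext => u; rewrite mulNr.
- exact: is_derive_cst.
Qed.

Local Notation g := (sol_metric eps).

Lemma sol_metricE x i j : g x i j = gcoef (x 0 i3) i *+ (i == j).
Proof. by rewrite !mxE. Qed.

Lemma invmx_solE x i j : invmx (g x) i j = (gcoef (x 0 i3) i)^-1 *+ (i == j).
Proof.
have -> : invmx (g x) = diag_mx (\row_i (gcoef (x 0 i3) i)^-1).
  set D := diag_mx _.
  have DE : g x *m D = 1%:M.
    rewrite mulmx_diag -diag_const_mx; congr diag_mx; apply/rowP => k.
    by rewrite !mxE mulfV // gcoef_neq0.
  have [gu _] := mulmx1_unit DE.
  by rewrite -[RHS](mulKmx gu) DE mulmx1.
by rewrite !mxE.
Qed.

Lemma partial_metric (k l j : 'I_3) x :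
  partial k (fun y => g y l j) x
  = (2 * grate l * gcoef (x 0 i3) l) *+ ((k == i3) && (l == j)).
Proof.
rewrite (_ : (fun y => _) = fun y : 'rV[R]_3 => (gcoef^~ l *+ (l == j)) (y 0 i3));
    last first.
  by apply/funext => y; rewrite sol_metricE; case: eqP.
case: (eqVneq k i3) => [->|ki]; last first.
  by rewrite partial_other.
case: eqP => _ /=; last first.
  by rewrite /partial derive_cst.
have := is_derive_coord _ (coordv R i3) _ _ _ (is_derive_gcoef (x 0 i3) l).
rewrite /partial => d; rewrite (@derive_val _ _ _ _ _ _ _ d).
by rewrite mxE !eqxx mul1r.
Qed.

(** * Connection coefficients *)

(** The Levi-Civita coefficients of a diagonal metric that depends on [X_3]
    only; [eps] stands for the inverse of [g_33]. *)
Definition sol_christoffel (al k j : 'I_3) (t : R) : R :=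
  grate al *+ ((k == i3) && (al == j)) + grate al *+ ((j == i3) && (al == k))
  - (eps * grate k * gcoef t k) *+ ((al == i3) && (k == j)).

Lemma christoffelE al k j x : christoffel g al k j x = sol_christoffel al k j (x 0 i3).
Proof.
rewrite /christoffel sum3E !partial_metric !invmx_solE /sol_christoffel.
have := gcoef_neq0 (x 0 i3) i1; have := gcoef_neq0 (x 0 i3) i2.
have := gcoef_neq0 (x 0 i3) i3.
have epsV : eps^-1 = eps.
  by rewrite -[LHS]mul1r -eps2 mulfK // -(gcoefE (x 0 i3)) gcoef_neq0.
by elim/ord3_ind: al; elim/ord3_ind: k; elim/ord3_ind: j;
  rewrite !eqxx !ord3_eqE /= ?mulr1n ?mulr0n !gcoefE ?grateE ?epsV => ? ? ?; field.
Qed.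

(** * The splitting of the metric and its curvature-like tensors *)

(** The restriction of the metric to the leaves [X_3 = const]. *)
Definition hform : form2 R 3 := fun x u v =>
  gcoef (x 0 i3) i1 * u 0 i1 * v 0 i1 + gcoef (x 0 i3) i2 * u 0 i2 * v 0 i2.

(** Half the derivative of [hform] along [X_3]; up to sign and [eps] it is the
    second fundamental form of the leaves. *)
Definition bform : form2 R 3 := fun x u v =>
  gcoef (x 0 i3) i1 * u 0 i1 * v 0 i1 - gcoef (x 0 i3) i2 * u 0 i2 * v 0 i2.

Definition eta_sq : form2 R 3 := fun _ u v => u 0 i3 * v 0 i3.

Lemma metric_formE x u v :
  metric_form g x u v = hform x u v + eps * (u 0 i3 * v 0 i3).
Proof.
rewrite /metric_form mul_mx_diag mxE sum3E !mxE /= /hform.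
by rewrite !gcoefE; ring.
Qed.

(** The curvature-like tensors that are invariant under rotations of the leaves.
    The curvatures [R], [C], [K] and [W] are all of this form. *)
Definition hcurv (p q : R) : form4 R 3 :=
  p *: kulkarni_nomizu hform eta_sq + q *: kulkarni_nomizu hform hform.

Lemma hcurvE p q x u1 u2 u3 u4 : hcurv p q x u1 u2 u3 u4 =
  p * (hform x u1 u4 * (u2 0 i3 * u3 0 i3) - hform x u1 u3 * (u2 0 i3 * u4 0 i3)
       + hform x u2 u3 * (u1 0 i3 * u4 0 i3) - hform x u2 u4 * (u1 0 i3 * u3 0 i3))
  + q * (hform x u1 u4 * hform x u2 u3 - hform x u1 u3 * hform x u2 u4
         + hform x u2 u3 * hform x u1 u4 - hform x u2 u4 * hform x u1 u3).
Proof. by []. Qed.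

(** * The curvature tensor *)

Local Notation nab := (semisym_conn g (sol_Phat a)).

(** The bilinear map [Gamma(u, v)] of the Levi-Civita connection. *)
Definition sol_gamma (x u v : 'rV[R]_3) : 'rV[R]_3 := \row_al
   ((u 0 i3 * v 0 al + v 0 i3 * u 0 al) * grate al - eps * bform x u v *+ (al == i3)).

Lemma semisym_connE X Y x :
  nab X Y x = 'D_(X x) Y x + sol_gamma x (X x) (Y x)
              + (eps * a (x 0 i3) * Y x 0 i3) *: X x.
Proof.
rewrite /semisym_conn /levi_civita; congr (_ + _ + _ *: _).
  apply/rowP => al; rewrite !mxE !sum3E !christoffelE.
  rewrite /sol_christoffel /sol_gamma /bform ?mxE.
  by elim/ord3_ind: al; rewrite !eqxx !ord3_eqE /= ?mulr1n ?mulr0n ?gcoefE ?grateE; ring.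
rewrite metric_formE /hform !mxE !ord3_eqE eqxx !mulr0 !mul0r /=; ring.
Qed.

Lemma conn_coefE al k j x : conn_coef nab al k j x =
  sol_christoffel al k j (x 0 i3) + (eps * a (x 0 i3)) *+ ((j == i3) && (al == k)).
Proof.
rewrite /conn_coef semisym_connE derive_cst !mxE /sol_christoffel /bform /coordv.
by elim/ord3_ind: al; elim/ord3_ind: k; elim/ord3_ind: j;
  rewrite !mxE !eqxx !ord3_eqE /= ?mulr1n ?mulr0n ?gcoefE ?grateE; ring.
Qed.

Lemma is_derive_sol_christoffel al k j t :
  is_derive t (1 : R) (sol_christoffel al k j)
    (- (eps * grate k * (2 * grate k * gcoef t k)) *+ ((al == i3) && (k == j))).
Proof.
rewrite (_ : sol_christoffel al k j = cst (grate al *+ ((k == i3) && (al == j))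
    + grate al *+ ((j == i3) && (al == k)))
  + (- (eps * grate k) *+ ((al == i3) && (k == j))) \*: (gcoef^~ k)); last first.
  apply/funext => u; rewrite /sol_christoffel fctE /=.
  by case: (_ && (k == j)); rewrite ?mulr1n ?mulr0n ?subr0 ?scale0r ?addr0 // scaleNr.
have d := is_derive_gcoef t k.
apply: is_derive_eq; rewrite add0r.
by case: (_ && (k == j)); rewrite ?mulr1n ?mulr0n ?scale0r //;
  rewrite /GRing.scale /=; ring.
Qed.

(** The function [a] drops out: in the coefficient with last index [j] it occurs
    only for [j = 3], and it varies only along [X_3], so its derivative could
    appear only for [i = j = 3], where the left-hand side is zero whether or not
    [a] is differentiable. *)
Lemma partial_conn_coefB al k j i x :
  partial i (conn_coef nab al k j) x - partial j (conn_coef nab al k i) x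
  = - (eps * grate k * (2 * grate k * gcoef (x 0 i3) k)) *+ (al == i3)
    * (((k == j) && (i == i3))%:R - ((k == i) && (j == i3))%:R).
Proof.
have connE l : conn_coef nab al k l = fun y =>
    (sol_christoffel al k l
     + (fun t => (eps * a t) *+ ((l == i3) && (al == k)))) (y 0 i3).
  by apply/funext => y; rewrite conn_coefE.
have off l m : m != i3 -> partial m (conn_coef nab al k l) x = 0.
  by move=> mi; rewrite connE partial_other.
have along l : l != i3 -> partial i3 (conn_coef nab al k l) x
   = - (eps * grate k * (2 * grate k * gcoef (x 0 i3) k)) *+ ((al == i3) && (k == l)).
  move=> li; rewrite connE (negbTE li) /= [X in _ + X](_ : _ = cst 0) ?addr0; last first.
    by apply/funext => t; rewrite mulr0n.
  have := is_derive_coord x (coordv R i3) i3 _ _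
    (is_derive_sol_christoffel al k l (x 0 i3)).
  rewrite /partial => d; rewrite (@derive_val _ _ _ _ _ _ _ d).
  by rewrite mxE !eqxx mul1r.
have [->|ij] := eqVneq i j; first by rewrite !subrr mulr0.
have [ii|ii] := eqVneq i i3; have [jj|jj] := eqVneq j i3; rewrite ?andbT ?andbF.
- by move: ij; rewrite ii jj eqxx.
- by rewrite ii along // off // !subr0 mulr_natr -mulrnA mulnb.
- by rewrite jj along // off // !sub0r mulrN mulr_natr -mulrnA mulnb.
- by rewrite !off // !subr0 mulr0.
Qed.

(** In the quadratic part the terms in [a] are symmetric in [i] and [j], so they
    cancel in every component. *)
Lemma riemann_coefE h k i j x : riemann_coef g nab h k i j x =
  hcurv 1 (- eps / 2) x (coordv R h) (coordv R k) (coordv R i) (coordv R j).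
Proof.
rewrite /riemann_coef.
have -> (F : 'I_3 -> R) : \sum_al g x h al * F al = gcoef (x 0 i3) h * F h.
  rewrite sum3E !sol_metricE; elim/ord3_ind: h;
  by rewrite !eqxx !ord3_eqE !mulr0n !mul0r ?add0r ?addr0.
rewrite sum3E partial_conn_coefB !conn_coefE hcurvE /hform /sol_christoffel !mxE.
move: (gcoefE (x 0 i3)) => coefE.
elim/ord3_ind: k; elim/ord3_ind: j; elim/ord3_ind: i; elim/ord3_ind: h.
all: rewrite /=.
all: rewrite ?mulr0n ?mulr1n ?grateE ?coefE.
all: by field: eps2.
Qed.

(** Multilinearity: the components in the coordinate frame determine the
    tensor. *)
Lemma hcurv_basis p q x (u1 u2 u3 u4 : 'rV[R]_3) :
  \sum_h \sum_k \sum_i \sum_j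
    hcurv p q x (coordv R h) (coordv R k) (coordv R i) (coordv R j)
      * u1 0 h * u2 0 k * u3 0 i * u4 0 j = hcurv p q x u1 u2 u3 u4.
Proof.
(* Expansion in one slot at a time keeps the polynomials small. *)
have T1 v2 v3 v4 : hcurv p q x u1 v2 v3 v4
    = \sum_h hcurv p q x (coordv R h) v2 v3 v4 * u1 0 h.
  by rewrite sum3E !hcurvE /hform !mxE /=; ring.
have T2 v1 v3 v4 : hcurv p q x v1 u2 v3 v4
    = \sum_h hcurv p q x v1 (coordv R h) v3 v4 * u2 0 h.
  by rewrite sum3E !hcurvE /hform !mxE /=; ring.
have T3 v1 v2 v4 : hcurv p q x v1 v2 u3 v4
    = \sum_h hcurv p q x v1 v2 (coordv R h) v4 * u3 0 h.
  by rewrite sum3E !hcurvE /hform !mxE /=; ring.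
have T4 v1 v2 v3 : hcurv p q x v1 v2 v3 u4
    = \sum_h hcurv p q x v1 v2 v3 (coordv R h) * u4 0 h.
  by rewrite sum3E !hcurvE /hform !mxE /=; ring.
rewrite T1; apply: eq_bigr => h _; rewrite T2 mulr_suml; apply: eq_bigr => k _.
rewrite T3 !mulr_suml; apply: eq_bigr => i _; rewrite T4 !mulr_suml.
by apply: eq_bigr => j _; ring.
Qed.

Lemma riemannE : riemann g nab = hcurv 1 (- eps / 2).
Proof.
apply/funext => x; apply/funext => u1; apply/funext => u2; apply/funext => u3.
apply/funext => u4; rewrite -hcurv_basis; apply: eq_bigr => h _.
apply: eq_bigr => k _; apply: eq_bigr => i _; apply: eq_bigr => j _.
by rewrite riemann_coefE.
Qed.

(** * Raising an index and the derived curvature tensors *)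

Lemma metric_form_basis x w l :
  metric_form g x w (coordv R l) = gcoef (x 0 i3) l * w 0 l.
Proof.
rewrite metric_formE /hform.
by elim/ord3_ind: l; rewrite !mxE /= ?gcoefE; ring.
Qed.

(** Nondegeneracy of the metric. Endomorphisms and Ricci operators are identified
    through this characterisation, which avoids computing with inverses. *)
Lemma sharpE x (phi : 'rV[R]_3 -> R) w :
  (forall v, phi v = metric_form g x w v) -> sharp g x phi = w.
Proof.
move=> phiE; apply/rowP => al; rewrite mxE sum3E !invmx_solE // !phiE.
rewrite !metric_form_basis.
have n0 := gcoef_neq0 (x 0 i3) al.
rewrite -[RHS](mulKf n0).
by elim/ord3_ind: al n0 => n0 /=; rewrite !mulr0n mulr1n !mul0r ?addr0 ?add0r.
Qed.

Lemma endo_hcurvE p q x u1 u2 u3 : endo g (hcurv p q) x u1 u2 u3 =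
  (p * (u2 0 i3 * u3 0 i3) + 2 * q * hform x u2 u3) *: (u1 - u1 0 i3 *: coordv R i3)
  - (p * (u1 0 i3 * u3 0 i3) + 2 * q * hform x u1 u3) *: (u2 - u2 0 i3 *: coordv R i3)
  + (p * eps * (u1 0 i3 * hform x u2 u3 - u2 0 i3 * hform x u1 u3)) *: coordv R i3.
Proof.
apply: sharpE => v; rewrite metric_formE hcurvE /hform !mxE /=.
by ring: eps2.
Qed.

(** Every tensor the endomorphism acts on is a polynomial in [h] and [eta], so that
    its products with [h] and [eta] determine the action. *)
Lemma hform_endo p q x u1 u2 y v : hform x (endo g (hcurv p q) x u1 u2 y) v =
  (p * (u2 0 i3 * y 0 i3) + 2 * q * hform x u2 y) * hform x u1 v
  - (p * (u1 0 i3 * y 0 i3) + 2 * q * hform x u1 y) * hform x u2 v.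
Proof. by rewrite endo_hcurvE /hform !mxE /=; ring. Qed.

Lemma hformC x u v : hform x u v = hform x v u.
Proof. by rewrite /hform; ring. Qed.

(* Puts the arguments of every hform in a fixed order, so that ring sees one
   atom per unordered pair of vectors. *)
Ltac sort_hform x y1 y2 y3 y4 u1 u2 :=
  rewrite ?(hformC x y1 u1) ?(hformC x y1 u2) ?(hformC x y2 u1)
          ?(hformC x y2 u2) ?(hformC x y3 u1) ?(hformC x y3 u2)
          ?(hformC x y4 u1) ?(hformC x y4 u2) ?(hformC x y2 y1)
          ?(hformC x y3 y1) ?(hformC x y4 y1) ?(hformC x y3 y2)
          ?(hformC x y4 y2) ?(hformC x y4 y3).

Lemma eta_endo p q x u1 u2 y : endo g (hcurv p q) x u1 u2 y 0 i3 =
  p * eps * (u1 0 i3 * hform x u2 y - u2 0 i3 * hform x u1 y).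
Proof. by rewrite endo_hcurvE !mxE /=; ring. Qed.

(** * The derivations attached to the curvature tensors *)

(** The span of the products [h h] and [h (eta (x) eta)] over the pairings of the
    arguments by (14)(23) and (13)(24). It contains every [hcurv], and also the
    projective tensor, which is not antisymmetric in its last two arguments. *)
Definition pairing_tensor (c1 c2 c3 c4 c5 c6 : R) : form4 R 3 := fun x y1 y2 y3 y4 =>
  c1 * (hform x y1 y4 * hform x y2 y3) + c2 * (hform x y1 y3 * hform x y2 y4)
  + c3 * (hform x y1 y4 * (y2 0 i3 * y3 0 i3))
  + c4 * (hform x y1 y3 * (y2 0 i3 * y4 0 i3))
  + c5 * (hform x y2 y3 * (y1 0 i3 * y4 0 i3))
  + c6 * (hform x y2 y4 * (y1 0 i3 * y3 0 i3)).

(** The tensor [hcurv p q] is [p eps / 2] times [g ^ g] plus a multiple of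
    [h ^ h]. The first acts as [p eps Q(g, _)] on every tensor, the second is a
    rotation of the leaves and kills [h] and [eta]. *)
Lemma curv_dot_pairing p q c1 c2 c3 c4 c5 c6 :
  curv_dot g (hcurv p q) (pairing_tensor c1 c2 c3 c4 c5 c6)
  = (p * eps) *: tachibana (metric_form g) (pairing_tensor c1 c2 c3 c4 c5 c6).
Proof.
apply: form6P => x y1 y2 y3 y4 u1 u2.
rewrite scale6E /curv_dot /tachibana /pairing_tensor.
rewrite !(hformC x _ (endo _ _ _ _ _ _)) !hform_endo !eta_endo.
rewrite !metric_formE.
sort_hform x y1 y2 y3 y4 u1 u2.
by ring: eps2.
Qed.

Lemma hcurv_pairing p q : hcurv p q = pairing_tensor (2 * q) (- (2 * q)) p (- p) p (- p).
Proof. by apply: form4P => x *; rewrite hcurvE /pairing_tensor; ring. Qed.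

Lemma ricci_hcurv p q x y1 y2 : ricci_of g (hcurv p q) x y1 y2
  = 2 * p * (y1 0 i3 * y2 0 i3) + (2 * q + p * eps) * hform x y1 y2.
Proof.
rewrite /ricci_of sum3E !endo_hcurvE /hform !mxE /=.
by ring.
Qed.

(** * Ricci, scalar, conharmonic, concircular, conformal and projective tensors *)

Definition sol_riemann : form4 R 3 := hcurv 1 (- eps / 2).

Lemma ricciE : ricci_of g sol_riemann = fun x u v => 2 * (u 0 i3 * v 0 i3).
Proof.
apply/funext => x; apply/funext => u; apply/funext => v; rewrite ricci_hcurv.
by field.
Qed.

Lemma scalarE x : scalar_of g (ricci_of g sol_riemann) x = 2 * eps.
Proof.
have := gcoef_neq0 (x 0 i3) i3; rewrite gcoefE => e0.
rewrite /scalar_of ricciE !sum3E !invmx_solE // !mxE /= !mulr0n !mulr1n !gcoefE.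
rewrite !(mulr0, mul0r, add0r, addr0, mulr1) -[2 * eps](mulKf e0).
by congr (_ * _); ring: eps2.
Qed.

Local Notation P := (projective g sol_riemann).

Lemma conharmonicE : conharmonic g sol_riemann = hcurv (-1) (- eps / 2).
Proof.
apply: form4P => x y1 y2 y3 y4.
rewrite /conharmonic ricciE.
change (sol_riemann x y1 y2 y3 y4 - (3%:R - 2)^-1 * kulkarni_nomizu (metric_form g)
   (fun x u v => 2 * (u 0 i3 * v 0 i3)) x y1 y2 y3 y4
  = hcurv (-1) (- eps / 2) x y1 y2 y3 y4).
rewrite /kulkarni_nomizu !metric_formE /sol_riemann !hcurvE.
by field.
Qed.

Lemma concircularE : concircular g sol_riemann = hcurv (2 / 3) (- (2 * eps / 3)).
Proof.
apply: form4P => x y1 y2 y3 y4.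
change (sol_riemann x y1 y2 y3 y4
  - scalar_of g (ricci_of g sol_riemann) x / (2 * 3%:R * (3%:R - 1)) *
  kulkarni_nomizu (metric_form g) (metric_form g) x y1 y2 y3 y4 =
   hcurv (2 / 3) (- (2 * eps / 3)) x y1 y2 y3 y4).
rewrite scalarE /kulkarni_nomizu !metric_formE /sol_riemann !hcurvE.
by field: eps2.
Qed.

(** The Weyl tensor of a semi-Riemannian 3-manifold vanishes; here the torsion of
    the connection does not spoil this, as the curvature does not see [a]. *)
Lemma conformalE : conformal g sol_riemann = hcurv 0 0.
Proof.
apply: form4P => x y1 y2 y3 y4.
change (conharmonic g sol_riemann x y1 y2 y3 y4 + scalar_of g (ricci_of g sol_riemann) x
   / (2 * (3%:R - 1) * (3%:R - 2)) *
  kulkarni_nomizu (metric_form g) (metric_form g) x y1 y2 y3 y4 =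
   hcurv 0 0 x y1 y2 y3 y4).
rewrite scalarE conharmonicE /kulkarni_nomizu !metric_formE !hcurvE.
by field: eps2.
Qed.

Lemma projective_pairing : P = pairing_tensor (- eps) eps 0 (-1) 1 0.
Proof.
apply: form4P => x y1 y2 y3 y4.
rewrite /projective ricciE !metric_formE /sol_riemann hcurvE /pairing_tensor.
by field.
Qed.

(** Since [Ric = 2 eta (x) eta], the correction in [P] subtracts the endomorphism
    sending [y] to [eta(u2) eta(y) u1 - eta(u1) eta(y) u2], whose derivation is
    [Q(eta (x) eta, _)]. *)
Lemma endo_projectiveE x u1 u2 y : endo g P x u1 u2 y =
  endo g sol_riemann x u1 u2 y - (u2 0 i3 * y 0 i3) *: u1 + (u1 0 i3 * y 0 i3) *: u2.
Proof.
apply: sharpE => v.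
rewrite endo_hcurvE metric_formE projective_pairing /pairing_tensor /hform !mxE /=.
by field: eps2.
Qed.

Lemma hform_endo_projective x u1 u2 y v : hform x (endo g P x u1 u2 y) v =
  - eps * (hform x u2 y * hform x u1 v - hform x u1 y * hform x u2 v).
Proof. by rewrite endo_projectiveE endo_hcurvE /hform !mxE /=; field. Qed.

Lemma eta_endo_projective x u1 u2 y : endo g P x u1 u2 y 0 i3 =
  eps * (u1 0 i3 * hform x u2 y - u2 0 i3 * hform x u1 y).
Proof. by rewrite endo_projectiveE endo_hcurvE !mxE /=; ring. Qed.

Lemma curv_dot_projective_pairing c1 c2 c3 c4 c5 c6 :
  curv_dot g P (pairing_tensor c1 c2 c3 c4 c5 c6)
  = eps *: tachibana (metric_form g) (pairing_tensor c1 c2 c3 c4 c5 c6)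
    - tachibana eta_sq (pairing_tensor c1 c2 c3 c4 c5 c6).
Proof.
apply: form6P => x y1 y2 y3 y4 u1 u2.
rewrite sub6E scale6E /curv_dot /tachibana /pairing_tensor.
rewrite !(hformC x _ (endo _ _ _ _ _ _)) !hform_endo_projective !eta_endo_projective.
rewrite !metric_formE /eta_sq.
sort_hform x y1 y2 y3 y4 u1 u2.
by ring: eps2.
Qed.

(** * The Tachibana tensors *)

(** All the tensors [Q(Z, T)] of the theorem with [T] an [hcurv] are multiples of
    this one. *)
Definition eta_tachibana : form6 R 3 := tachibana eta_sq (kulkarni_nomizu hform hform).

(** The coefficient of [t^2] in [Q(Z, Z ^ Z) = 0] at [Z = h + t eta (x) eta] gives
    [Q(eta (x) eta, h ^ (eta (x) eta)) = 0], because the Kulkarni-Nomizu square of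
    [eta (x) eta] is zero. *)
Lemma tachibana_eta_hcurv p q : tachibana eta_sq (hcurv p q) = q *: eta_tachibana.
Proof.
apply: form6P => x y1 y2 y3 y4 u1 u2.
rewrite scale6E /eta_tachibana /tachibana !hcurvE /kulkarni_nomizu /eta_sq.
sort_hform x y1 y2 y3 y4 u1 u2.
by ring.
Qed.

(** The coefficient of [t] in [Q(Z, Z ^ Z) = 0] at [Z = h + t eta (x) eta] gives
    [Q(h, h ^ (eta (x) eta)) = - Q(eta (x) eta, h ^ h) / 2]. *)
Lemma tachibana_metric_hcurv p q :
  tachibana (metric_form g) (hcurv p q) = (eps * q - p / 2) *: eta_tachibana.
Proof.
apply: form6P => x y1 y2 y3 y4 u1 u2.
rewrite scale6E /eta_tachibana /tachibana !hcurvE /kulkarni_nomizu /eta_sq !metric_formE.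
sort_hform x y1 y2 y3 y4 u1 u2.
by field.
Qed.

Lemma tachibana_ricci F : tachibana (ricci_of g sol_riemann) F = 2 *: tachibana eta_sq F.
Proof.
apply: form6P => x y1 y2 y3 y4 u1 u2; rewrite scale6E /tachibana ricciE /eta_sq.
by ring.
Qed.

Lemma curv_dot_hcurv p q p' q' :
  curv_dot g (hcurv p q) (hcurv p' q') = (p * (q' - eps * p' / 2)) *: eta_tachibana.
Proof.
rewrite (hcurv_pairing p' q') curv_dot_pairing -hcurv_pairing.
rewrite tachibana_metric_hcurv scalerA.
by congr (_ *: _); field: eps2.
Qed.

Lemma curv_dot_projective p q : curv_dot g P (hcurv p q)
  = (- (eps * p / 2)) *: eta_tachibana.
Proof.
rewrite (hcurv_pairing p q) curv_dot_projective_pairing -(hcurv_pairing p q).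
rewrite tachibana_metric_hcurv.
rewrite tachibana_eta_hcurv; apply: form6P => *; rewrite sub6E !scale6E.
by field: eps2.
Qed.

(** * Ricci conditions and decomposition of the curvature *)

Local Notation Ric := (ricci_of g sol_riemann).

Lemma eps_neq0 : eps != 0.
Proof. by rewrite -(gcoefE 0) gcoef_neq0. Qed.

Lemma form2_mx_ricci x : form2_mx Ric x = 2 *: delta_mx i3 i3.
Proof.
apply/matrixP => i j; rewrite !mxE ricciE // !mxE.
by elim/ord3_ind: i; elim/ord3_ind: j; rewrite /=; ring.
Qed.

Lemma ricci_simpleE : ricci_simple g Ric.
Proof.
move=> x; rewrite scale0r subr0 form2_mx_ricci.
by rewrite mxrank_scale_nz ?mxrank_delta ?pnatr_eq0.
Qed.

(** With [eps = 1] the [33] entries of [Ric] and [2 g] agree, so that exactly the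
    two leaf directions survive. *)
Lemma rank_ricci_sub_metric_pos x : eps = 1 -> \rank (form2_mx Ric x - 2 *: g x) = 2%N.
Proof.
move=> e1.
(* The last diagonal entry of D is arbitrary nonzero: pid_mx 2 cancels it. *)
pose D : 'M[R]_3 := diag_mx (\row_i (if i == i3 then 1 else - 2 * gcoef (x 0 i3) i)).
have Du : row_free D.
  rewrite row_free_unit unitmxE det_diag unitfE; apply/prodf_neq0 => i _.
  by rewrite mxE; case: (i == i3); rewrite ?oner_eq0 //
    mulf_neq0 ?gcoef_neq0 // oppr_eq0 pnatr_eq0.
rewrite (_ : _ - _ = pid_mx 2 *m D) ?mxrankMfree ?rank_pid_mx //.
rewrite form2_mx_ricci mul_mx_diag; apply/matrixP => i j.
by elim/ord3_ind: i; elim/ord3_ind: j;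
  rewrite !mxE /= ?mulr0n ?mulr1n ?gcoefE ?e1; ring.
Qed.

(** With [eps = -1] the [33] entry is [2 + 2 = 4]. *)
Lemma rank_ricci_sub_metric_neg x : eps = -1 -> \rank (form2_mx Ric x - 2 *: g x) = 3%N.
Proof.
move=> e1; apply: mxrank_unit.
rewrite (_ : _ - _ = diag_mx (\row_i ((if i == i3 then 4 else - 2) *
   (if i == i3 then 1 else gcoef (x 0 i3) i)))).
  rewrite unitmxE det_diag unitfE; apply/prodf_neq0 => i _; rewrite mxE.
  by case: (i == i3); rewrite mulf_neq0 ?oner_eq0 ?gcoef_neq0 ?oppr_eq0 ?pnatr_eq0.
rewrite form2_mx_ricci; apply/matrixP => i j.
by elim/ord3_ind: i; elim/ord3_ind: j;
  rewrite !mxE /= ?mulr0n ?mulr1n ?gcoefE ?e1; ring.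
Qed.

Lemma oper_r_ricci x v :
  oper_r g Ric x v = (2 * eps * v 0 i3) *: coordv R i3.
Proof.
apply: sharpE => // u; rewrite ricciE // metric_formE /hform !mxE /=.
by ring: eps2.
Qed.

Lemma oper_l_ricci x v :
  oper_l g Ric x v = (2 * eps * v 0 i3) *: coordv R i3.
Proof.
apply: sharpE => // u; rewrite ricciE // metric_formE /hform !mxE /=.
by ring: eps2.
Qed.

Lemma ricci_pow2 : form2_pow g Ric 2 = (2 * eps) *: Ric.
Proof.
apply/funext => x; apply/funext => u; apply/funext => v.
rewrite -[RHS]/(2 * eps * Ric x u v) /form2_pow /= !oper_r_ricci ricciE //.
rewrite metric_formE /hform !mxE /=.
by ring: eps2.
Qed.

Lemma ricci_einstein_level2 : einstein_level2 g Ric.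
Proof.
exists (fun _ => - (2 * eps)), (fun _ => 0).
do 2!(split; first exact: smooth_const).
rewrite ricci_pow2; apply/funext => x; apply/funext => u; apply/funext => v.
rewrite -[LHS]/(2 * eps * Ric x u v + - (2 * eps) * Ric x u v
  + 0 * metric_form g x u v) -[RHS]/(0 : R).
by ring.
Qed.

(** The Ricci operator maps every vector to a multiple of [d_3]. Inserting [d_3]
    first leaves a multiple of [eta(y1) (h(u, y2) eta(y3) - h(u, y3) eta(y2))],
    whose cyclic sum is zero. *)
Lemma compatible_hcurv p q : compatible g Ric (hcurv p q).
Proof.
move=> x u y1 y2 y3; rewrite !oper_l_ricci !hcurvE /hform !mxE /=.
by ring.
Qed.

Lemma riemann_roterE : sol_riemann = kulkarni_nomizu (metric_form g) Ric
   - (eps / 2) *: kulkarni_nomizu (metric_form g) (metric_form g).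
Proof.
apply: form4P => x y1 y2 y3 y4.
rewrite -[RHS]/(kulkarni_nomizu (metric_form g) Ric x y1 y2 y3 y4 -
  eps / 2 * kulkarni_nomizu (metric_form g) (metric_form g) x y1 y2 y3 y4).
rewrite /kulkarni_nomizu ricciE // !metric_formE /sol_riemann hcurvE.
by field: eps2.
Qed.

Lemma generalized_roterE : generalized_roter g sol_riemann.
Proof.
exists (fun=> 0), (fun=> 0), (fun=> 0), (fun=> 0), (fun=> 1), (fun=> - (eps / 2)).
split; first by do 5!(split; first exact: smooth_const); exact: smooth_const.
apply: form4P => x y1 y2 y3 y4.
rewrite {1}riemann_roterE /kulkarni_nomizu /scale_fun /scale_fun2 !fctE.
rewrite /GRing.scale /=.
by ring.
Qed.

(** * Covariant derivatives *)

(** The components of [nabla h] and [nabla eta]; the first argument is the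
    direction of differentiation. *)
Definition nabla_hform (x u v w : 'rV[R]_3) : R :=
  - (v 0 i3 * bform x u w + w 0 i3 * bform x u v)
  - eps * a (x 0 i3) * (v 0 i3 * hform x u w + w 0 i3 * hform x u v).

Definition nabla_eta (x u v : 'rV[R]_3) : R :=
  eps * bform x u v - eps * a (x 0 i3) * (u 0 i3 * v 0 i3).

Lemma is_derive_hform (Y Z : vfield R 3) x v :
  differentiable Y x -> differentiable Z x ->
  is_derive x v (fun y => hform y (Y y) (Z y))
    (hform x ('D_v Y x) (Z x) + hform x (Y x) ('D_v Z x)
     + 2 * v 0 i3 * bform x (Y x) (Z x)).
Proof.
move=> dY dZ.
have Gd i := is_derive_coord x v i3 _ _ (is_derive_gcoef (x 0 i3) i).
have Yd i := is_derive_entry Y x v i dY.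
have Zd i := is_derive_entry Z x v i dZ.
have d := is_deriveD (is_deriveM (is_deriveM (Gd i1) (Yd i1)) (Zd i1))
  (is_deriveM (is_deriveM (Gd i2) (Yd i2)) (Zd i2)).
apply: (is_derive_eq d).
by rewrite /hform /bform !fctE !grateE /GRing.scale /=; ring.
Qed.

(** The Leibniz rule for [nab], which reduces covariant derivatives of polynomials
    in [h] and [eta] to [nabla_hform] and [nabla_eta]. *)
Lemma is_derive_hform_nab (X Y Z : vfield R 3) x :
  differentiable Y x -> differentiable Z x ->
  is_derive x (X x) (fun y => hform y (Y y) (Z y))
    (hform x (nab X Y x) (Z x) + hform x (Y x) (nab X Z x)
     + nabla_hform x (X x) (Y x) (Z x)).
Proof.
move=> dY dZ; have d := is_derive_hform Y Z x (X x) dY dZ.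
apply: (is_derive_eq d); rewrite !semisym_connE //.
rewrite /nabla_hform /hform /bform !mxE /= ?ord3_eqE ?mulr0n !grateE /bform.
by ring.
Qed.

Lemma is_derive_eta_nab (X Y : vfield R 3) x :
  differentiable Y x ->
  is_derive x (X x) (fun y => Y y 0 i3 : R)
    (nab X Y x 0 i3 + nabla_eta x (X x) (Y x)).
Proof.
move=> dY; have d := is_derive_entry Y x (X x) i3 dY.
apply: (is_derive_eq d); rewrite semisym_connE // /nabla_eta !mxE /= grateE mulr1n.
by ring.
Qed.

Definition nabla_hcurv p q (x u v1 v2 v3 v4 : 'rV[R]_3) : R :=
  p * (nabla_hform x u v1 v4 * (v2 0 i3 * v3 0 i3)
       + hform x v1 v4 * (nabla_eta x u v2 * v3 0 i3 + v2 0 i3 * nabla_eta x u v3)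
       - nabla_hform x u v1 v3 * (v2 0 i3 * v4 0 i3)
       - hform x v1 v3 * (nabla_eta x u v2 * v4 0 i3 + v2 0 i3 * nabla_eta x u v4)
       + nabla_hform x u v2 v3 * (v1 0 i3 * v4 0 i3)
       + hform x v2 v3 * (nabla_eta x u v1 * v4 0 i3 + v1 0 i3 * nabla_eta x u v4)
       - nabla_hform x u v2 v4 * (v1 0 i3 * v3 0 i3)
       - hform x v2 v4 * (nabla_eta x u v1 * v3 0 i3 + v1 0 i3 * nabla_eta x u v3))
  + 2 * q * (nabla_hform x u v1 v4 * hform x v2 v3 + hform x v1 v4 * nabla_hform x u v2 v3
           - nabla_hform x u v1 v3 * hform x v2 v4 - hform x v1 v3 * nabla_hform x u v2 v4).

(** Tensoriality: the derivatives of the vector fields cancel, so that the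
    covariant derivative depends on their values only. *)
Lemma cov_deriv4_hcurv p q (X Y1 Y2 Y3 Y4 : vfield R 3) x :
  differentiable Y1 x -> differentiable Y2 x -> differentiable Y3 x ->
  differentiable Y4 x ->
  cov_deriv4 nab (hcurv p q) X Y1 Y2 Y3 Y4 x
  = nabla_hcurv p q x (X x) (Y1 x) (Y2 x) (Y3 x) (Y4 x).
Proof.
move=> d1 d2 d3 d4; rewrite /cov_deriv4.
have E1 := is_derive_eta_nab X Y1 x d1; have E2 := is_derive_eta_nab X Y2 x d2.
have E3 := is_derive_eta_nab X Y3 x d3; have E4 := is_derive_eta_nab X Y4 x d4.
have H14 := is_derive_hform_nab X Y1 Y4 x d1 d4.
have H13 := is_derive_hform_nab X Y1 Y3 x d1 d3.
have H23 := is_derive_hform_nab X Y2 Y3 x d2 d3.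
have H24 := is_derive_hform_nab X Y2 Y4 x d2 d4.
have D := is_deriveD
  (is_deriveZ p (is_deriveB (is_deriveD (is_deriveB
     (is_deriveM H14 (is_deriveM E2 E3)) (is_deriveM H13 (is_deriveM E2 E4)))
     (is_deriveM H23 (is_deriveM E1 E4))) (is_deriveM H24 (is_deriveM E1 E3))))
  (is_deriveZ q (is_deriveB (is_deriveD (is_deriveB
     (is_deriveM H14 H23) (is_deriveM H13 H24)) (is_deriveM H23 H14))
     (is_deriveM H24 H13))).
pose T y := hcurv p q y (Y1 y) (Y2 y) (Y3 y) (Y4 y).
rewrite (@derive_val _ _ _ _ _ _ _ (D : is_derive x (X x) T _)).
rewrite !hcurvE /nabla_hcurv !fctE /GRing.scale /=.
by ring.
Qed.

(** In the cyclic sum the terms with [b(v_i, v_j)] cancel by symmetry, and the other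
    terms in [b] combine into products of [eta] with
    [h(v1, s) b(v2, t) - h(v2, s) b(v1, t) - h(v1, t) b(v2, s) + h(v2, t) b(v1, s)],
    which is zero because [b] is [h]-trace-free in dimension two. The function [a]
    contributes to [nabla_X T] a term [- eps a eta(v) T] for each argument [v] of
    [T], with [v] replaced by [X]. Those from the first two arguments give twice
    [eps a eta(X) T] by antisymmetry; those from the last two vanish by the first
    Bianchi identity. *)
Lemma recurrent_hcurv p q :
  recurrent_2forms nab (hcurv p q) (fun x u => 2 * eps * a (x 0 i3) * u 0 i3).
Proof.
move=> Y1 Y2 Y3 U Y s1 s2 s3 sU sY x.
have d1 := s1 [::] x; have d2 := s2 [::] x; have d3 := s3 [::] x.
have dU := sU [::] x; have dY := sY [::] x.
rewrite !cov_deriv4_hcurv // !hcurvE /nabla_hcurv /nabla_hform /nabla_eta /hform /bform.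
by ring: eps2.
Qed.

Lemma cov_deriv2_ricci (X Y Z : vfield R 3) x :
  differentiable Y x -> differentiable Z x ->
  cov_deriv2 nab Ric X Y Z x
  = 2 * (nabla_eta x (X x) (Y x) * Z x 0 i3 + Y x 0 i3 * nabla_eta x (X x) (Z x)).
Proof.
move=> dY dZ; rewrite /cov_deriv2 ricciE //.
have D := is_deriveZ 2 (is_deriveM (is_derive_eta_nab X Y x dY)
                                   (is_derive_eta_nab X Z x dZ)).
pose T y := 2 * (Y y 0 i3 * Z y 0 i3).
rewrite (@derive_val _ _ _ _ _ _ _ (D : is_derive x (X x) T _)).
rewrite /GRing.scale /=.
by ring.
Qed.

Lemma eps_gcoef1_neq0 : 2 * (eps * gcoef 0 i1) != 0.
Proof. by rewrite !mulf_neq0 ?pnatr_eq0 ?gcoef_neq0 ?eps_neq0. Qed.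

(** Tested on [d_1, d_3, d_1]: one side is [2 eps e^(2 X_3)], the other zero. *)
Lemma not_codazzi : ~ codazzi nab Ric.
Proof.
have s3 (i : 'I_3) : smooth (fun _ : 'rV[R]_3 => coordv R i) by exact: smooth_const.
have d3 (i : 'I_3) : differentiable (fun _ : 'rV[R]_3 => coordv R i) 0.
  exact: (s3 i [::]).
move=> /(_ _ _ _ (s3 i1) (s3 i3) (s3 i1) 0).
rewrite !cov_deriv2_ricci // /nabla_eta /bform !mxE /= => e0.
by apply/negP: eps_gcoef1_neq0; rewrite negbK; apply/eqP; lra.
Qed.

(** Tested on [d_1, d_1, d_3]: the sum is [4 eps e^(2 X_3)]. *)
Lemma not_cyclic_parallel : ~ cyclic_parallel nab Ric.
Proof.
have s3 (i : 'I_3) : smooth (fun _ : 'rV[R]_3 => coordv R i) by exact: smooth_const.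
have d3 (i : 'I_3) : differentiable (fun _ : 'rV[R]_3 => coordv R i) 0.
  exact: (s3 i [::]).
move=> /(_ _ _ _ (s3 i1) (s3 i1) (s3 i3) 0).
rewrite !cov_deriv2_ricci // /nabla_eta /bform !mxE /= => e0.
by apply/negP: eps_gcoef1_neq0; rewrite negbK; apply/eqP; lra.
Qed.
End Sol.

(** * The theorem *)

Lemma conj_from (A B : Prop) : A -> (A -> B) -> A /\ B.
Proof. by move=> a b; split=> //; exact: b. Qed.

Theorem theorem3p1 (R : realType) (eps : R) (heps : eps = 1 \/ eps = -1)
    (a : R -> R) (ha : continuous a) :
  let g := sol_metric eps in
  let G := metric_form g in
  let nab := semisym_conn g (sol_Phat a) in
  let Rm := riemann g nab in
  let Ric := ricci_of g Rm in
  let C := conformal g Rm in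
  let K := conharmonic g Rm in
  let W := concircular g Rm in
  let P := projective g Rm in
  let eta : form1 R 3 := fun _ u => u 0 i3 in
  let sigma : form1 R 3 := fun x u => 2 * eps * a (x 0 i3) * u 0 i3 in
  (* I *)
  ((curv_dot g C Rm = 0 /\
    curv_dot g K Rm = - tachibana Ric Rm /\
    curv_dot g W Rm = (2 / 3 : R) *: tachibana Ric Rm /\
    curv_dot g P Rm = (1 / 2 : R) *: tachibana Ric Rm /\
    curv_dot g K Rm = - eps *: tachibana G Rm /\
    curv_dot g W Rm = (2 / 3 * eps) *: tachibana G Rm /\
    curv_dot g P Rm = (1 / 2 * eps) *: tachibana G Rm /\
    curv_dot g Rm C = 0 /\
    curv_dot g C C = 0 /\
    curv_dot g K C = 0 /\
    curv_dot g W C = 0 /\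
    curv_dot g P C = 0 /\
    curv_dot g Rm K = 0 /\
    curv_dot g C K = 0 /\
    curv_dot g K K = 0 /\
    curv_dot g W K = 0 /\
    curv_dot g P K = - (1 / 2 : R) *: tachibana Ric K /\
    curv_dot g Rm W = (3 / 4 : R) *: tachibana Ric W /\
    curv_dot g K W = - (3 / 4 : R) *: tachibana Ric W /\
    curv_dot g W W = (1 / 2 : R) *: tachibana Ric W /\
    curv_dot g P W = (1 / 4 : R) *: tachibana Ric W /\
    curv_dot g Rm W = eps *: tachibana G W /\
    curv_dot g K W = - eps *: tachibana G W /\
    curv_dot g W W = (2 / 3 * eps) *: tachibana G W /\
    curv_dot g P W = (1 / 3 * eps) *: tachibana G W /\
    curv_dot g Rm P = eps *: tachibana G P /\
    curv_dot g K P = - eps *: tachibana G P /\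
    curv_dot g W P = (2 / 3 * eps) *: tachibana G P) /\
   (* the resulting type conditions, as "F-... type due to E" *)
   (semisymmetric_type g Rm C /\
    semisymmetric_type g C Rm /\
    semisymmetric_type g C C /\
    semisymmetric_type g C K /\
    semisymmetric_type g C W /\
    semisymmetric_type g C P /\
    semisymmetric_type g K Rm /\
    semisymmetric_type g K C /\
    semisymmetric_type g K K /\
    semisymmetric_type g K W) /\
   (ricci_gen_pseudosymmetric_type g Ric Rm K /\
    ricci_gen_pseudosymmetric_type g Ric Rm W /\
    ricci_gen_pseudosymmetric_type g Ric Rm P /\
    ricci_gen_pseudosymmetric_type g Ric K P /\
    ricci_gen_pseudosymmetric_type g Ric W Rm /\
    ricci_gen_pseudosymmetric_type g Ric W K /\
    ricci_gen_pseudosymmetric_type g Ric W W /\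
    ricci_gen_pseudosymmetric_type g Ric W P) /\
   (pseudosymmetric_type g G Rm K /\
    pseudosymmetric_type g G Rm W /\
    pseudosymmetric_type g G Rm P /\
    pseudosymmetric_type g G W Rm /\
    pseudosymmetric_type g G W K /\
    pseudosymmetric_type g G W W /\
    pseudosymmetric_type g G W P /\
    pseudosymmetric_type g G P Rm /\
    pseudosymmetric_type g G P K /\
    pseudosymmetric_type g G P W)) /\
  (* II *)
  (Ric = (fun x u v => 2 * (eta x u * eta x v)) /\
   ricci_simple g Ric /\
   (eps = 1 -> quasi_einstein_with g Ric (fun _ => 2) 2 /\
               quasi_einstein g Ric 2) /\
   (eps = -1 -> quasi_einstein_with g Ric (fun _ => 2) 3 /\
                quasi_einstein g Ric 3)) /\
  (* III *)
  (Rm = kulkarni_nomizu G Ric - (eps / 2) *: kulkarni_nomizu G G /\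
   generalized_roter g Rm) /\
  (* IV *)
  (form2_pow g Ric 2 - (2 * eps) *: Ric = 0 /\ einstein_level2 g Ric) /\
  (* V *)
  (~ codazzi nab Ric /\ ~ cyclic_parallel nab Ric) /\
  (* VI *)
  (compatible g Ric Rm /\ compatible g Ric C /\
   compatible g Ric K /\ compatible g Ric W) /\
  (* VII *)
  (recurrent_2forms nab Rm sigma /\
   recurrent_2forms nab K sigma /\
   recurrent_2forms nab W sigma).
Proof.
move=> g G nab Rm0 Ric C K W P eta sigma.
have eps2 : eps * eps = 1 by case: heps => ->; rewrite ?mulrNN mulr1.
have RmE : Rm0 = sol_riemann eps by exact: riemannE.
rewrite /Ric /C /K /W /P; move: Rm0 RmE {Ric C K W P} => _ ->.
rewrite conformalE // conharmonicE // concircularE //.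
(* Only the following two properties of P enter the products E . F. *)
have dotPT := curv_dot_projective eps eps2.
have dotP q p : curv_dot g (hcurv eps q p) (projective g (sol_riemann eps))
    = (q * eps) *: tachibana G (projective g (sol_riemann eps)).
  by rewrite projective_pairing // curv_dot_pairing.
have QRic F := tachibana_ricci eps eps2 F.
move: (projective g (sol_riemann eps)) dotP dotPT => P dotP dotPT.
split.
  (* The type conditions are consequences of the identities. *)
  apply: conj_from.
    rewrite !QRic /sol_riemann !dotPT !curv_dot_hcurv // !dotP !tachibana_eta_hcurv //.
    rewrite !tachibana_metric_hcurv //.
    (* Each side is now a multiple of B, or of Q(g, P) when F is P. *)
    move: (eta_tachibana eps) => B.
    by do !split; apply: form6P => *; rewrite ?opp6E !scale6E ?zero6E; field: eps2.
  move=> [I1 [I2 [I3 [I4 [I5 [I6 [I7 [I8 [I9 [I10 [I11 [I12 [I13 [I14 [I15 [I16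
    [I17 [I18 [I19 [I20 [I21 [I22 [I23 [I24 [I25 [I26 [I27 I28
    ]]]]]]]]]]]]]]]]]]]]]]]]]]].
  split; first by do 9!(split=> //).
  split.
    have ricci_gen := @ricci_gen_pseudosymmetric_type_of R g.
    split; first by apply: (ricci_gen _ _ _ (-1)) => *; rewrite I2 opp6E mulN1r.
    split; first by apply: (ricci_gen _ _ _ (2 / 3)) => *; rewrite I3.
    split; first by apply: (ricci_gen _ _ _ (1 / 2)) => *; rewrite I4.
    split; first by apply: (ricci_gen _ _ _ (- (1 / 2))) => *; rewrite I17.
    split; first by apply: (ricci_gen _ _ _ (3 / 4)) => *; rewrite I18.
    split; first by apply: (ricci_gen _ _ _ (- (3 / 4))) => *; rewrite I19.
    split; first by apply: (ricci_gen _ _ _ (1 / 2)) => *; rewrite I20.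
    by apply: (ricci_gen _ _ _ (1 / 4)) => *; rewrite I21.
  split; first by apply: (pseudosymmetric_type_of _ _ _ _ (- eps)) => *; rewrite I5.
  split; first by apply: (pseudosymmetric_type_of _ _ _ _ (2 / 3 * eps)) => *; rewrite I6.
  split; first by apply: (pseudosymmetric_type_of _ _ _ _ (1 / 2 * eps)) => *; rewrite I7.
  split; first by apply: (pseudosymmetric_type_of _ _ _ _ eps) => *; rewrite I22.
  split; first by apply: (pseudosymmetric_type_of _ _ _ _ (- eps)) => *; rewrite I23.
  split; first by apply: (pseudosymmetric_type_of _ _ _ _ (2 / 3 * eps)) => *; rewrite I24.
  split; first by apply: (pseudosymmetric_type_of _ _ _ _ (1 / 3 * eps)) => *; rewrite I25.
  split; first by apply: (pseudosymmetric_type_of _ _ _ _ eps) => *; rewrite I26.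
  split; first by apply: (pseudosymmetric_type_of _ _ _ _ (- eps)) => *; rewrite I27.
  by apply: (pseudosymmetric_type_of _ _ _ _ (2 / 3 * eps)) => *; rewrite I28.
have quasi k :
    (forall x, \rank (form2_mx (ricci_of g (sol_riemann eps)) x - 2 *: g x) = k) ->
    quasi_einstein_with g (ricci_of g (sol_riemann eps)) (fun _ => 2) k /\
    quasi_einstein g (ricci_of g (sol_riemann eps)) k.
  by move=> rk; split=> //; exists (fun _ => 2) => //; exact: smooth_const.
split.
  split; first exact: ricciE.
  split; first exact: ricci_simpleE.
  by split=> e1; apply: quasi => x; [exact: rank_ricci_sub_metric_pos|
    exact: rank_ricci_sub_metric_neg].
split; first by split; [exact: riemann_roterE|exact: generalized_roterE].
split.
  split; last exact: ricci_einstein_level2.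
  by rewrite ricci_pow2 // subrr.
split; first by split; [exact: not_codazzi|exact: not_cyclic_parallel].
split; first by do 3!(split; first exact: compatible_hcurv); exact: compatible_hcurv.
by do 2!(split; first exact: recurrent_hcurv); exact: recurrent_hcurv.
Qed.
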